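(* Let $M={}_{f_2}M_1\times_{f_1}M_2$ be a pseudo-Riemannian doubly warped product with metric $g=f_2^2g_1+f_1^2g_2$, and let $\bar g=\bar g_1+\bar g_2$ be the product metric on $M_1\times M_2$, where $\bar g_i=\frac{1}{f_i^2}g_i$. Then: (1) for each $i=1,2$, a Killing vector field $\zeta=\zeta_i$ on $(M_i,\bar g_i)$ (lifted to $M$) is a Killing vector field on $(M,\bar g)$; (2) $(M,\bar g)$ admits a homothetic vector field if and only if $(M_i,\bar g_i)$ admits a homothetic vector field for each $i=1,2$; (3) each conformal vector field on $(M,\bar g)$ is a conformal vector field on $(M,g)$.
   Context: $(M_1,g_1)$ and $(M_2,g_2)$ are pseudo-Riemannian manifolds and $f_i:M_i\to(0,\infty)$ are smooth functions. The doubly warped product is $M_1\times M_2$ with metric $g=(f_2\circ\pi_2)^2\pi_1^*g_1+(f_1\circ\pi_1)^2\pi_2^*g_2$, where $\pi_i$ is the projection onto $M_i$; functions on $M_i$ are identified with their pullbacks, and vector fields on $M_i$ with their lifts to $M$. A vector field $\zeta$ on $(N,h)$ is conformal with conformal factor $\rho\in C^\infty(N)$ if $\mathcal L_\zeta h=\rho h$; it is homothetic if $\rho$ is constant and Killing if $\rho=0$. *)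

(* Defs.v *)
From HB Require Import structures.
From mathcomp Require Import all_boot all_order all_algebra.
From mathcomp Require Import all_classical all_reals all_analysis.

Set Implicit Arguments.
Unset Strict Implicit.
Unset Printing Implicit Defensive.

Import Order.TTheory GRing.Theory Num.Theory.
Import numFieldNormedType.Exports.

Local Open Scope classical_set_scope.
Local Open Scope ring_scope.

(* Manifolds are topological spaces with a smooth
   atlas indexed by a type; the atlas need not be maximal.  Tensor fields are
   families of components, one per chart, related by the usual transformation
   laws; a component family indexed by [i] is only meaningful on [dom i].
   Tangent vectors are row vectors. *)

(* Only meaningful for open [U] in finite dimension. *)
Fixpoint Ck_on (R : realType) (V W : normedModType R) (k : nat)
    (U : set V) (f : V -> W) : Prop :=
  match k with
  | 0%N => forall x, U x -> {for x, continuous f}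
  | k'.+1 => (forall x, U x -> differentiable f x) /\
             (forall v, Ck_on k' U ('D_v f))
  end.

Definition smooth_on (R : realType) (V W : normedModType R)
    (U : set V) (f : V -> W) : Prop := forall k, Ck_on k U f.

(* [par i] inverts [coord i] on its image; outside of it, and outside of
   [dom i], both maps take arbitrary values. *)
Record atlas (R : realType) (M : topologicalType) (n : nat) := Atlas {
  idx : Type;
  dom : idx -> set M;
  coord : idx -> M -> 'rV[R]_n;
  par : idx -> 'rV[R]_n -> M
}.

Definition codom (R : realType) (M : topologicalType) (n : nat)
    (A : atlas R M n) (i : idx A) : set 'rV[R]_n := coord i @` dom i.

Definition transition (R : realType) (M : topologicalType) (n : nat)
    (A : atlas R M n) (i j : idx A) : 'rV[R]_n -> 'rV[R]_n :=
  coord j \o par i.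

Definition smooth_manifold (R : realType) (M : topologicalType) (n : nat)
    (A : atlas R M n) : Prop :=
  [/\ [set: M] !=set0, hausdorff_space M & @second_countable M] /\
  [/\ forall p, exists i : idx A, dom i p,
      forall i : idx A, open (dom i) /\ open (codom i),
      forall (i : idx A) p, dom i p -> par i (coord i p) = p,
      forall i : idx A,
        (forall p, dom i p -> {for p, continuous (coord i)}) /\
        (forall x, codom i x -> {for x, continuous (par i)}) &
      forall i j : idx A,
        smooth_on (coord i @` (dom i `&` dom j)) (transition i j)].

Definition smooth_fun (R : realType) (M : topologicalType) (n : nat)
    (A : atlas R M n) (f : M -> R) : Prop :=
  forall i : idx A, smooth_on (codom i) (f \o par i : 'rV[R]_n -> R^o).

Definition vfield (R : realType) (M : topologicalType) (n : nat)
  (A : atlas R M n) := idx A -> M -> 'rV[R]_n.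

Definition tensor2 (R : realType) (M : topologicalType) (n : nat)
  (A : atlas R M n) := idx A -> M -> 'M[R]_n.

Definition bilin (R : realType) (n : nat) (B : 'M[R]_n) (u v : 'rV[R]_n) : R :=
  (u *m B *m v^T) 0 0.

Definition smooth_vfield (R : realType) (M : topologicalType) (n : nat)
    (A : atlas R M n) (X : vfield A) : Prop :=
  (forall i, smooth_on (codom i) (X i \o par i)) /\
  (forall i j p, dom i p -> dom j p ->
     X j p = 'D_(X i p) (transition i j) (coord i p)).

Definition smooth_tensor2 (R : realType) (M : topologicalType) (n : nat)
    (A : atlas R M n) (h : tensor2 A) : Prop :=
  (forall i, smooth_on (codom i) (h i \o par i)) /\
  (forall i j p, dom i p -> dom j p -> forall u v,
     bilin (h i p) u v =
     bilin (h j p) ('D_u (transition i j) (coord i p))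
                   ('D_v (transition i j) (coord i p))).

Definition neg_def_on (R : realType) (n m : nat) (B : 'M[R]_n)
    (W : 'M[R]_(m, n)) : Prop :=
  forall u : 'rV[R]_n, (u <= W)%MS -> u != 0 -> bilin B u u < 0.

(* The maximal dimension of a subspace on which [B] is negative definite is
   [q]; subspaces are row spaces of matrices with independent rows. *)
Definition has_index (R : realType) (n : nat) (B : 'M[R]_n) (q : nat) : Prop :=
  (exists W : 'M[R]_(q, n), row_free W /\ neg_def_on B W) /\
  (forall (m : nat) (W : 'M[R]_(m, n)),
     row_free W -> neg_def_on B W -> (m <= q)%N).

Definition pseudo_riemannian (R : realType) (M : topologicalType) (n : nat)
    (A : atlas R M n) (h : tensor2 A) : Prop :=
  [/\ smooth_tensor2 h,
      forall i p, dom i p -> (h i p)^T = h i p,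
      forall i p, dom i p -> h i p \in unitmx &
      exists q, forall i p, dom i p -> has_index (h i p) q].

Definition bracket (R : realType) (n : nat) (X Y : 'rV[R]_n -> 'rV[R]_n) :
    'rV[R]_n -> 'rV[R]_n :=
  fun x => 'D_(X x) Y x - 'D_(Y x) X x.

(* (L_X h)(Y, Z) = X(h(Y, Z)) - h([X, Y], Z) - h(Y, [X, Z]), read in a chart. *)
Definition lie_deriv (R : realType) (n : nat) (h : 'rV[R]_n -> 'M[R]_n)
    (X Y Z : 'rV[R]_n -> 'rV[R]_n) : 'rV[R]_n -> R :=
  fun x => 'D_(X x) (fun y => bilin (h y) (Y y) (Z y) : R^o) x
           - bilin (h x) (bracket X Y x) (Z x)
           - bilin (h x) (Y x) (bracket X Z x).

(* [L_X h = rho h], the two tensor fields being compared on all local vector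
   fields [Y] and [Z] defined on a chart domain. *)
Definition conformal_with (R : realType) (M : topologicalType) (n : nat)
    (A : atlas R M n) (h : tensor2 A) (X : vfield A) (rho : M -> R) : Prop :=
  [/\ smooth_vfield X, smooth_fun A rho &
      forall (i : idx A) (Y Z : 'rV[R]_n -> 'rV[R]_n),
        smooth_on (codom i) Y -> smooth_on (codom i) Z ->
        forall x, codom i x ->
          lie_deriv (h i \o par i) (X i \o par i) Y Z x =
          rho (par i x) * bilin (h i (par i x)) (Y x) (Z x)].

Definition conformal (R : realType) (M : topologicalType) (n : nat)
    (A : atlas R M n) (h : tensor2 A) (X : vfield A) : Prop :=
  exists rho : M -> R, conformal_with h X rho.

Definition homothetic (R : realType) (M : topologicalType) (n : nat)
    (A : atlas R M n) (h : tensor2 A) (X : vfield A) : Prop :=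
  exists c : R, conformal_with h X (cst c).

(* Excludes Killing fields, in particular the zero field. *)
Definition proper_homothetic (R : realType) (M : topologicalType) (n : nat)
    (A : atlas R M n) (h : tensor2 A) (X : vfield A) : Prop :=
  exists2 c : R, c != 0 & conformal_with h X (cst c).

Definition killing (R : realType) (M : topologicalType) (n : nat)
    (A : atlas R M n) (h : tensor2 A) (X : vfield A) : Prop :=
  conformal_with h X (cst 0).

Definition prod_atlas (R : realType) (M1 M2 : topologicalType) (n1 n2 : nat)
    (A1 : atlas R M1 n1) (A2 : atlas R M2 n2) :
    atlas R (M1 * M2)%type (n1 + n2) :=
  @Atlas R (M1 * M2)%type (n1 + n2) (idx A1 * idx A2)%type
    (fun i => dom i.1 `*` dom i.2)
    (fun i p => row_mx (coord i.1 p.1) (coord i.2 p.2))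
    (fun i x => (par i.1 (lsubmx x), par i.2 (rsubmx x))).

Definition lift1 (R : realType) (M1 M2 : topologicalType) (n1 n2 : nat)
    (A1 : atlas R M1 n1) (A2 : atlas R M2 n2) (X : vfield A1) :
    vfield (prod_atlas A1 A2) :=
  fun i p => row_mx (X i.1 p.1) 0.
Arguments lift1 {R M1 M2 n1 n2 A1} A2 X _ _.

Definition lift2 (R : realType) (M1 M2 : topologicalType) (n1 n2 : nat)
    (A1 : atlas R M1 n1) (A2 : atlas R M2 n2) (X : vfield A2) :
    vfield (prod_atlas A1 A2) :=
  fun i p => row_mx 0 (X i.2 p.2).
Arguments lift2 {R M1 M2 n1 n2} A1 {A2} X _ _.

(* The differential of a projection is [lsubmx] or [rsubmx] in product charts,
   so that the pulled back tensor has a single nonzero block. *)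
Definition pull1 (R : realType) (M1 M2 : topologicalType) (n1 n2 : nat)
    (A1 : atlas R M1 n1) (A2 : atlas R M2 n2) (h : tensor2 A1) :
    tensor2 (prod_atlas A1 A2) :=
  fun i p => block_mx (h i.1 p.1) 0 0 0.
Arguments pull1 {R M1 M2 n1 n2 A1} A2 h _ _.

Definition pull2 (R : realType) (M1 M2 : topologicalType) (n1 n2 : nat)
    (A1 : atlas R M1 n1) (A2 : atlas R M2 n2) (h : tensor2 A2) :
    tensor2 (prod_atlas A1 A2) :=
  fun i p => block_mx 0 0 0 (h i.2 p.2).
Arguments pull2 {R M1 M2 n1 n2} A1 {A2} h _ _.

Definition prod_metric (R : realType) (M1 M2 : topologicalType) (n1 n2 : nat)
    (A1 : atlas R M1 n1) (A2 : atlas R M2 n2)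
    (h1 : tensor2 A1) (h2 : tensor2 A2) : tensor2 (prod_atlas A1 A2) :=
  fun i p => pull1 A2 h1 i p + pull2 A1 h2 i p.

Definition doubly_warped (R : realType) (M1 M2 : topologicalType)
    (n1 n2 : nat) (A1 : atlas R M1 n1) (A2 : atlas R M2 n2)
    (g1 : tensor2 A1) (g2 : tensor2 A2) (f1 : M1 -> R) (f2 : M2 -> R) :
    tensor2 (prod_atlas A1 A2) :=
  fun i p => f2 p.2 ^+ 2 *: pull1 A2 g1 i p + f1 p.1 ^+ 2 *: pull2 A1 g2 i p.

Definition conformal_change (R : realType) (M : topologicalType) (n : nat)
    (A : atlas R M n) (s : M -> R) (h : tensor2 A) : tensor2 A :=
  fun i p => s p *: h i p.

(* Main.v *)
(** In a chart, the Leibniz rule turns [(L_X h)(Y, Z)] into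
    [(D_X h)(Y, Z) + h(D_Y X, Z) + h(Y, D_Z X)], which only depends on the
    values of [Y] and [Z] at the point.  Hence [L_X h = rho h] is a pointwise identity
    between bilinear forms.  For a product metric both sides are block diagonal,
    so that a sum of lifts of fields with the same constant factor [c] is
    homothetic with factor [c], and conversely the component along [M1] of a
    homothetic field, restricted to a slice [M1 x {q}], is homothetic on [M1]
    with the same factor.  A proper homothetic field can be rescaled to any
    nonzero factor, whence (2).  For (3), [g = s gbar] with [s = f1^2 f2^2], and
    [L_X (s gbar) = (rho + X(s) / s) (s gbar)]. *)

From HB Require Import structures.
Require Import Defs.
From mathcomp Require Import all_boot all_order all_algebra.
From mathcomp Require Import all_classical all_reals all_analysis.
From mathcomp Require Import ring.

Set Implicit Arguments.
Unset Strict Implicit.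
Unset Printing Implicit Defensive.

Import Order.TTheory GRing.Theory Num.Theory.
Import numFieldNormedType.Exports.
Import Defs.

Local Open Scope classical_set_scope.
Local Open Scope ring_scope.

(** * Derivatives of matrix-valued functions *)

(** Expanding [B] in the basis [delta_mx i j] makes [f] a finite sum of entries of [B] times fixed
    vectors, and entries are continuous. Block projections and embeddings thereby need no separate
    continuity argument. *)
Lemma linear_mx_continuous (R : realType) (m n : nat) (W : normedModType R)
    (f : {linear 'M[R]_(m, n) -> W}) : continuous f.
Proof.
have -> : (f : 'M[R]_(m, n) -> W) =
    fun B => \sum_i \sum_j B i j *: f (delta_mx i j).
  apply/funext => B; rewrite {1}(matrix_sum_delta B) linear_sum.
  apply: eq_bigr => i _; rewrite linear_sum.
  by apply: eq_bigr => j _; rewrite linearZ.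
have cD : continuous (fun x : W * W => x.1 + x.2) by exact: add_continuous.
apply: (continuous_big (P := xpredT) cD) => i _.
apply: (continuous_big (P := xpredT) cD) => j _ A.
exact: (cvgZr_tmp (@coord_continuous R m n i j A)).
Qed.

Lemma differentiable_linear_mx (R : realType) (m n : nat) (W : normedModType R)
    (f : {linear 'M[R]_(m, n) -> W}) (x : 'M[R]_(m, n)) : differentiable f x.
Proof. exact/linear_differentiable/linear_mx_continuous. Qed.

(** The first-order expansion of [f] at [x] is also one for [g], since the two agree at [x] and near
    it; uniqueness of the differential then identifies ['d g x] with ['d f x]. *)
Lemma near_eq_differentiable (R : realType) (V W : normedModType R)
    (f g : V -> W) (x : V) :
  (\near x, f x = g x) -> differentiable f x -> differentiable g x.
Proof.
move=> fg dfx; have fgx := nbhs_singleton fg.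
have dg : g \o shift x = cst (g x) + 'd f x +o_ 0 id.
  apply/eqaddoP => e e0.
  have := diff_locally dfx => /eqaddoP /(_ e e0).
  have : \forall y \near 0, f (y + x) = g (y + x).
    move: fg; rewrite (near_shift 0 x); apply: filterS => y /=.
    by rewrite subr0.
  apply: filterS2 => y fgy; rewrite /= !fctE /=.
  by rewrite fgy fgx.
have dE := diff_unique (diff_continuous dfx) dg.
by apply/diff_locallyP; rewrite dE; split=> //; apply: diff_continuous.
Qed.

Lemma derive_comp (R : realType) (U V W : normedModType R) (f : U -> V)
    (g : V -> W) (x v : U) :
  differentiable f x -> differentiable g (f x) ->
  'D_v (g \o f) x = 'D_('D_v f x) g (f x).
Proof.
move=> df dg; rewrite !deriveE//; last exact: differentiable_comp.
by rewrite diff_comp.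
Qed.

Lemma derive_linear (R : realType) (V W : normedModType R)
    (f : {linear V -> W}) (x v : V) : continuous f -> 'D_v f x = f v.
Proof.
by move=> cf; rewrite deriveE ?diff_lin//; apply: linear_differentiable.
Qed.

Lemma derive_linear_comp (R : realType) (V : normedModType R) (m n : nat)
    (W : normedModType R) (K : {linear 'M[R]_(m, n) -> W})
    (f : V -> 'M[R]_(m, n)) (x v : V) :
  differentiable f x -> 'D_v (fun y => K (f y)) x = K ('D_v f x).
Proof.
move=> df; rewrite (derive_comp v df (differentiable_linear_mx K _)).
exact/derive_linear/linear_mx_continuous.
Qed.

Lemma differentiable_mx (R : realType) (V : normedModType R) (m n : nat)
    (F : V -> 'M[R]_(m, n)) (x : V) :
  (forall i j, differentiable (fun y => F y i j) x) -> differentiable F x.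
Proof.
move=> dF.
have -> : F = \sum_i \sum_j (fun y => F y i j *: (delta_mx i j : 'M[R]_(m, n))).
  apply/funext => y; rewrite {1}(matrix_sum_delta (F y)) fct_sumE.
  by apply: eq_bigr => i _; rewrite fct_sumE.
apply: differentiable_sum => i; apply: differentiable_sum => j.
exact: differentiableZl.
Qed.

Lemma differentiable_entry (R : realType) (V : normedModType R) (m n : nat)
    (F : V -> 'M[R]_(m, n)) (x : V) i j :
  differentiable F x -> differentiable (fun y => F y i j) x.
Proof.
move=> dF; apply: (@differentiable_comp _ _ _ _ F (fun M => M i j)) => //.
exact: differentiable_coord.
Qed.

Lemma derive_entry (R : realType) (V : normedModType R) (m n : nat)
    (F : V -> 'M[R]_(m, n)) (x v : V) i j :
  differentiable F x -> 'D_v (fun y => F y i j) x = 'D_v F x i j.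
Proof. by move=> dF; rewrite derive_mx ?mxE//; apply: diff_derivable. Qed.

Lemma derive_dirZ (R : realType) (V W : normedModType R) (f : V -> W)
    (x u : V) (a : R) :
  differentiable f x -> 'D_(a *: u) f x = a *: 'D_u f x.
Proof. by move=> df; rewrite !deriveE// linearZ. Qed.

Lemma differentiable_scale (R : realType) (V : normedModType R) (m n : nat)
    (s : V -> R) (F : V -> 'M[R]_(m, n)) (x : V) :
  differentiable s x -> differentiable F x ->
  differentiable (fun y => s y *: F y) x.
Proof.
move=> ds dF; apply: differentiable_mx => i j.
have -> : (fun y => (s y *: F y) i j) = s * (fun y => F y i j).
  by apply/funext => y; rewrite mxE.
by apply: differentiableM => //; apply: differentiable_entry.
Qed.

Lemma derive_scale (R : realType) (V : normedModType R) (m n : nat)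
    (s : V -> R) (F : V -> 'M[R]_(m, n)) (x v : V) :
  differentiable s x -> differentiable F x ->
  'D_v (fun y => s y *: F y) x = 'D_v s x *: F x + s x *: 'D_v F x.
Proof.
move=> ds dF; apply/matrixP => i j.
rewrite -derive_entry; last exact: differentiable_scale.
have -> : (fun y => (s y *: F y) i j) = s * (fun y => F y i j).
  by apply/funext => y; rewrite mxE.
rewrite deriveM; last 2 first.
- exact: diff_derivable.
- exact/diff_derivable/differentiable_entry.
by rewrite derive_entry// !mxE addrC [_ *: 'D_v s x]mulrC.
Qed.

(** * Matrices as bilinear forms *)

Lemma bilinE (R : realType) (n : nat) (B : 'M[R]_n) (u v : 'rV[R]_n) :
  bilin B u v = \sum_i \sum_j u 0 i * B i j * v 0 j.
Proof.
rewrite /bilin mxE exchange_big; apply: eq_bigr => j _.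
by rewrite !mxE mulr_suml; apply: eq_bigr => i _.
Qed.

Lemma bilinDl (R : realType) (n : nat) (B : 'M[R]_n) u u' v :
  bilin B (u + u') v = bilin B u v + bilin B u' v.
Proof. by rewrite /bilin !mulmxDl mxE. Qed.

Lemma bilinNl (R : realType) (n : nat) (B : 'M[R]_n) u v :
  bilin B (- u) v = - bilin B u v.
Proof. by rewrite /bilin !mulNmx mxE. Qed.

Lemma bilinDr (R : realType) (n : nat) (B : 'M[R]_n) u v v' :
  bilin B u (v + v') = bilin B u v + bilin B u v'.
Proof. by rewrite /bilin linearD /= mulmxDr mxE. Qed.

Lemma bilinNr (R : realType) (n : nat) (B : 'M[R]_n) u v :
  bilin B u (- v) = - bilin B u v.
Proof. by rewrite /bilin linearN /= mulmxN mxE. Qed.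

Lemma bilinZl (R : realType) (n : nat) (B : 'M[R]_n) a u v :
  bilin B (a *: u) v = a * bilin B u v.
Proof. by rewrite /bilin -!scalemxAl mxE. Qed.

Lemma bilinZr (R : realType) (n : nat) (B : 'M[R]_n) a u v :
  bilin B u (a *: v) = a * bilin B u v.
Proof. by rewrite /bilin linearZ /= -scalemxAr mxE. Qed.

Lemma bilin0l (R : realType) (n : nat) (B : 'M[R]_n) v : bilin B 0 v = 0.
Proof. by rewrite /bilin !mul0mx mxE. Qed.

Lemma bilin0r (R : realType) (n : nat) (B : 'M[R]_n) u : bilin B u 0 = 0.
Proof. by rewrite /bilin trmx0 mulmx0 mxE. Qed.

Lemma bilin_addm (R : realType) (n : nat) (B C : 'M[R]_n) u v :
  bilin (B + C) u v = bilin B u v + bilin C u v.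
Proof. by rewrite /bilin mulmxDr mulmxDl mxE. Qed.

Lemma bilin_scalem (R : realType) (n : nat) (B : 'M[R]_n) a u v :
  bilin (a *: B) u v = a * bilin B u v.
Proof. by rewrite /bilin -scalemxAr -scalemxAl mxE. Qed.

(** In coordinates the form is a finite sum of triple products, and the Leibniz rule for three
    scalar factors is summed back into three forms. *)
Lemma derive_bilin (R : realType) (V : normedModType R) (n : nat)
    (h : V -> 'M[R]_n) (Y Z : V -> 'rV[R]_n) (x v : V) :
  differentiable h x -> differentiable Y x -> differentiable Z x ->
  'D_v (fun y => bilin (h y) (Y y) (Z y) : R^o) x =
  bilin ('D_v h x) (Y x) (Z x) + bilin (h x) ('D_v Y x) (Z x) +
  bilin (h x) (Y x) ('D_v Z x).
Proof.
move=> dh dY dZ.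
have dd i j : differentiable (fun y => Y y 0 i * h y i j : R^o) x.
  by apply: differentiableM; apply: differentiable_entry.
have ddd i j : differentiable (fun y => Y y 0 i * h y i j * Z y 0 j : R^o) x.
  by apply: differentiableM; [exact: dd | exact: differentiable_entry].
have -> : (fun y => bilin (h y) (Y y) (Z y) : R^o) =
    \sum_i \sum_j (fun y => Y y 0 i * h y i j * Z y 0 j : R^o).
  apply/funext => y; rewrite bilinE fct_sumE.
  by apply: eq_bigr => i _; rewrite fct_sumE.
rewrite derive_sum; last first.
  by move=> i; apply: derivable_sum => j; apply: diff_derivable; apply: ddd.
rewrite !bilinE -!big_split /=; apply: eq_bigr => i _.
rewrite derive_sum; last by move=> j; apply: diff_derivable; apply: ddd.
rewrite -!big_split /=; apply: eq_bigr => j _.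
rewrite (@deriveM _ _ (fun y => Y y 0 i * h y i j : R^o)
    (fun y => Z y 0 j : R^o));
  [|exact/diff_derivable/dd|exact/diff_derivable/differentiable_entry].
rewrite (@deriveM _ _ (fun y => Y y 0 i : R^o) (fun y => h y i j : R^o));
  [|exact/diff_derivable/differentiable_entry..].
rewrite !derive_entry// /GRing.scale /=.
by ring.
Qed.

(** * Calculus of C^k functions *)

Lemma Ck_onW (R : realType) (V W : normedModType R) (k : nat) (U : set V)
    (f : V -> W) : Ck_on k.+1 U f -> Ck_on k U f.
Proof.
elim: k f => [|k IH] f [df Df].
  by move=> x Ux; apply/differentiable_continuous/df.
by split=> // v; apply: IH.
Qed.

(** Openness turns equality on [U] into equality near each point, which differentiability and
    directional derivatives respect. The inductions below use it to replace a derivative by a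
    formula valid only on [U]. *)
Lemma Ck_on_eq (R : realType) (V W : normedModType R) (k : nat) (U : set V)
    (f g : V -> W) :
  open U -> (forall x, U x -> f x = g x) -> Ck_on k U f -> Ck_on k U g.
Proof.
move=> oU; elim: k f g => [|k IH] f g fg.
  move=> cf x Ux; have nfg : \near x, f x = g x.
    by apply: filterS (open_nbhs_nbhs (conj oU Ux)) => y /fg.
  have := cvg_trans (near_eq_cvg nfg) (cf x Ux).
  by rewrite fg//; apply.
have nfg x : U x -> \near x, f x = g x.
  by move=> Ux; apply: filterS (open_nbhs_nbhs (conj oU Ux)) => y /fg.
case=> df Df; split=> [x Ux|v].
  by apply: near_eq_differentiable (df x Ux); apply: nfg.
by apply: IH (Df v) => x Ux; apply: near_eq_derive; apply: nfg.
Qed.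

Lemma Ck_on_cst (R : realType) (V W : normedModType R) (k : nat) (U : set V)
    (a : W) : Ck_on k U (cst a : V -> W).
Proof.
elim: k a => [|k IH] a; first by move=> x _; apply: cvg_cst.
split=> [x _|v]; first exact: differentiable_cst.
have -> : 'D_v (cst a : V -> W) = cst 0 by apply/funext => x; apply: derive_cst.
exact: IH.
Qed.

Lemma Ck_on_add (R : realType) (V W : normedModType R) (k : nat) (U : set V)
    (f g : V -> W) : open U ->
  Ck_on k U f -> Ck_on k U g -> Ck_on k U (fun x => f x + g x).
Proof.
move=> oU; elim: k f g => [|k IH] f g.
  by move=> cf cg x Ux; apply: cvgD; [apply: cf | apply: cg].
case=> df Df [dg Dg]; split=> [x Ux|v].
  by apply: differentiableD; [apply: df | apply: dg].
apply: Ck_on_eq (IH _ _ (Df v) (Dg v)) => // x Ux /=.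
by rewrite -deriveD//; apply: diff_derivable; [apply: df | apply: dg].
Qed.

Lemma Ck_on_sum (R : realType) (V W : normedModType R) (k n : nat) (U : set V)
    (f : 'I_n -> V -> W) : open U ->
  (forall i, Ck_on k U (f i)) -> Ck_on k U (fun x => \sum_i f i x).
Proof.
move=> oU cf; elim: n f cf => [|n IH] f cf.
  apply: Ck_on_eq (@Ck_on_cst _ _ _ k U 0) => // x _.
  by rewrite big_ord0.
have := Ck_on_add oU (cf ord0) (IH _ (fun i => cf (lift ord0 i))).
by apply: Ck_on_eq => // x _; rewrite big_ord_recl.
Qed.

Lemma Ck_on_mul (R : realType) (V : normedModType R) (k : nat) (U : set V)
    (f g : V -> R^o) : open U ->
  Ck_on k U f -> Ck_on k U g -> Ck_on k U (fun x => f x * g x : R^o).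
Proof.
move=> oU; elim: k f g => [|k IH] f g.
  by move=> cf cg x Ux; apply: cvgM; [apply: cf | apply: cg].
move=> cf cg; have [[df Df] [dg Dg]] := (cf, cg); split=> [x Ux|v].
  by apply: differentiableM; [apply: df | apply: dg].
have := Ck_on_add oU (IH _ _ (Ck_onW cf) (Dg v)) (IH _ _ (Ck_onW cg) (Df v)).
apply: Ck_on_eq => // x Ux.
rewrite [RHS](@deriveM _ _ f g)//; apply: diff_derivable; first exact: df.
exact: dg.
Qed.

(** The derivative of [1 / f] is [- (1 / f) (1 / f) 'D_v f], a product whose factors are of class
    one lower by induction. *)
Lemma Ck_on_inv (R : realType) (V : normedModType R) (k : nat) (U : set V)
    (f : V -> R^o) : open U -> (forall x, U x -> f x != 0) ->
  Ck_on k U f -> Ck_on k U (fun x => (f x)^-1 : R^o).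
Proof.
move=> oU f0; elim: k => [|k IH] cf.
  by move=> x Ux; apply: cvgV; [apply: f0 | apply: cf].
have [df Df] := cf; split=> [x Ux|v].
  by apply: differentiableV; [apply: df | apply: f0].
have cV := IH (Ck_onW cf).
have := Ck_on_mul oU (@Ck_on_cst _ _ R^o k U (-1))
  (Ck_on_mul oU (Ck_on_mul oU cV cV) (Df v)).
apply: Ck_on_eq => // x Ux.
rewrite [RHS](@deriveV _ _ f)//; [|exact: f0|exact/diff_derivable/df].
by rewrite /cst mulN1r -scaleNr /GRing.scale /= expr2 invfM mulNr.
Qed.

(** The shape [K (f (L x + c))] is stable under differentiation: its derivative along [v] is the
    same expression with [f] replaced by ['D_(L v) f]. The induction therefore closes without a
    chain rule for general C^k maps. *)
Lemma Ck_on_affine (R : realType) (V V' W W' : normedModType R) (k : nat)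
    (U : set V') (S : set V) (L : {linear V -> V'}) (c : V')
    (K : {linear W -> W'}) (f : V' -> W) :
  continuous L -> continuous K -> open S -> (forall x, S x -> U (L x + c)) ->
  Ck_on k U f -> Ck_on k S (fun x => K (f (L x + c))).
Proof.
move=> cL cK oS SU; elim: k f => [|k IH] f.
  move=> cf x Sx; apply: (@continuous_comp _ _ _ (fun y => f (L y + c)) K).
    apply: (@continuous_comp _ _ _ (fun y => L y + c) f).
      by apply: cvgD; [exact: cL | exact: cvg_cst].
    exact/cf/SU.
  exact: cK.
case=> df Df.
have dA x : differentiable (fun y => L y + c) x.
  by apply: differentiableD => //; apply: linear_differentiable.
have dfA x : S x -> differentiable (fun y => f (L y + c)) x.
  move=> Sx; apply: (@differentiable_comp _ _ _ _ (fun y => L y + c) f) => //.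
  exact/df/SU.
split=> [x Sx|v].
  apply: (@differentiable_comp _ _ _ _ (fun y => f (L y + c)) K).
    exact: dfA.
  exact: linear_differentiable.
apply: Ck_on_eq (IH _ (Df (L v))) => // x Sx /=.
have dK y : differentiable K y by apply: linear_differentiable.
rewrite [RHS](derive_comp v (dfA x Sx) (dK _)) derive_linear//.
congr (K _).
rewrite [RHS](derive_comp (f := fun y => L y + c) v (dA x) (df _ (SU _ Sx))).
congr ('D_ _ f _).
by rewrite deriveD ?derive_cst ?addr0 ?derive_linear//;
  apply: diff_derivable => //; apply: linear_differentiable.
Qed.

Lemma smooth_on_differentiable (R : realType) (V W : normedModType R)
    (U : set V) (f : V -> W) (x : V) :
  smooth_on U f -> U x -> differentiable f x.
Proof. by move=> /(_ 1%N)[df _]; apply: df. Qed.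

Lemma smooth_on_comp_mx (R : realType) (m n p q : nat) (W : normedModType R)
    (U : set 'M[R]_(m, n)) (S : set 'M[R]_(p, q))
    (L : {linear 'M[R]_(p, q) -> 'M[R]_(m, n)}) (c : 'M[R]_(m, n))
    (f : 'M[R]_(m, n) -> W) :
  open S -> (forall x, S x -> U (L x + c)) ->
  smooth_on U f -> smooth_on S (fun x => f (L x + c)).
Proof.
move=> oS SU sf k.
apply: (Ck_on_affine (K := idfun) (linear_mx_continuous (f := L)) _ oS SU)
  => //.
by move=> x; apply: cvg_id.
Qed.

Lemma smooth_on_linear (R : realType) (V : normedModType R) (m n : nat)
    (W : normedModType R) (U : set V) (K : {linear 'M[R]_(m, n) -> W})
    (f : V -> 'M[R]_(m, n)) :
  open U -> smooth_on U f -> smooth_on U (fun x => K (f x)).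
Proof.
move=> oU sf k; apply: Ck_on_eq (_ : Ck_on k U (fun x => K (f (x + 0)))) => //.
  by move=> x _; rewrite addr0.
apply: (Ck_on_affine (L := idfun) _ (linear_mx_continuous (f := K)) oU) (sf k).
  by move=> x; apply: cvg_id.
by move=> x; rewrite /= addr0.
Qed.

Lemma smooth_on_entry (R : realType) (V : normedModType R) (m n : nat)
    (U : set V) (f : V -> 'M[R]_(m, n)) i j :
  open U -> smooth_on U f -> smooth_on U (fun x => f x i j : R^o).
Proof.
move=> oU sf.
have elin : linear (fun A : 'M[R]_(m, n) => A i j : R^o).
  by move=> a A B; rewrite !mxE.
pose eM := GRing.isLinear.Build _ _ _ _ _ elin.
pose e : {linear 'M[R]_(m, n) -> R^o} :=
  HB.pack (fun A : 'M[R]_(m, n) => A i j : R^o) eM.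
exact: (smooth_on_linear e oU sf).
Qed.

(** [Ck_on] controls derivatives in constant directions only, so the moving direction [X x] is
    expanded in the standard basis: the derivative is the sum of the entries of [X] times partial
    derivatives. *)
Lemma smooth_on_derive (R : realType) (n : nat) (U : set 'rV[R]_n)
    (X : 'rV[R]_n -> 'rV[R]_n) (f : 'rV[R]_n -> R^o) :
  open U -> smooth_on U X -> smooth_on U f ->
  smooth_on U (fun x => 'D_(X x) f x : R^o).
Proof.
move=> oU sX sf k.
apply: (Ck_on_eq
  (f := fun x => \sum_i (X x 0 i : R^o) * 'D_(delta_mx 0 i) f x)) => //.
  move=> x Ux; have df := smooth_on_differentiable sf Ux.
  rewrite [in RHS]deriveE// {2}(row_sum_delta (X x)) linear_sum.
  by apply: eq_bigr => i _; rewrite linearZ /= deriveE.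
apply: Ck_on_sum => // i; apply: Ck_on_mul => //.
  exact: smooth_on_entry.
by have [_] := sf k.+1; apply.
Qed.

Lemma differentiable_linear_comp (R : realType) (p q : nat)
    (V W : normedModType R)
    (K : {linear 'M[R]_(p, q) -> W}) (F : V -> 'M[R]_(p, q)) (x : V) :
  differentiable F x -> differentiable (fun y => K (F y)) x.
Proof.
move=> dF; apply: (@differentiable_comp _ _ _ _ F K) => //.
exact: differentiable_linear_mx.
Qed.

(** * Splitting row vectors and block diagonal forms over a product *)

Section RowMx.
Variables (R : realType) (n1 n2 : nat).

(** Writing a concatenation as a sum of two linear images lets the calculus rules for sums and
    linear maps apply to it; [block_diag_linear] does the same for block diagonal matrices. *)
Lemma row_mx_linear (a : 'rV[R]_n1) (b : 'rV[R]_n2) :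
  row_mx a b = mulmxr (row_mx 1%:M 0) a + mulmxr (row_mx 0 1%:M) b.
Proof. by rewrite /= !mul_mx_row !mulmx1 !mulmx0 add_row_mx addr0 add0r. Qed.

Lemma block_diag_linear (a : 'M[R]_n1) (b : 'M[R]_n2) :
  block_mx a 0 0 b =
  (mulmxr (row_mx 1%:M 0) \o mulmx (col_mx 1%:M 0)) a +
  (mulmxr (row_mx 0 1%:M) \o mulmx (col_mx 0 1%:M)) b.
Proof.
rewrite /= !mul_col_mx !mul1mx !mul0mx !mul_mx_row !mulmx1 !mulmx0.
by rewrite add_col_mx !addr0 !add0r.
Qed.

Lemma bilin_block (a : 'M[R]_n1) (b : 'M[R]_n2) (u v : 'rV[R]_(n1 + n2)) :
  bilin (block_mx a 0 0 b) u v =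
  bilin a (lsubmx u) (lsubmx v) + bilin b (rsubmx u) (rsubmx v).
Proof.
rewrite /bilin -{1}(hsubmxK u) -{1}(hsubmxK v) tr_row_mx mul_row_block.
by rewrite !mulmx0 addr0 add0r mul_row_col mxE.
Qed.

Lemma bilin_block_row (a : 'M[R]_n1) (b : 'M[R]_n2) u1 u2 v1 v2 :
  bilin (block_mx a 0 0 b) (row_mx u1 u2) (row_mx v1 v2) =
  bilin a u1 v1 + bilin b u2 v2.
Proof. by rewrite bilin_block !row_mxKl !row_mxKr. Qed.

Lemma smooth_on_row_mx (V : normedModType R) (U : set V) (f : V -> 'rV[R]_n1)
    (g : V -> 'rV[R]_n2) : open U ->
  smooth_on U f -> smooth_on U g -> smooth_on U (fun x => row_mx (f x) (g x)).
Proof.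
move=> oU sf sg k; under eq_fun do rewrite row_mx_linear.
by apply: Ck_on_add => //; apply: smooth_on_linear.
Qed.

Lemma differentiable_lsub_comp (W : normedModType R) (F : 'rV[R]_n1 -> W)
    (z : 'rV[R]_(n1 + n2)) :
  differentiable F (lsubmx z) -> differentiable (fun y => F (lsubmx y)) z.
Proof.
move=> dF; apply: (@differentiable_comp _ _ _ _ lsubmx F) => //.
exact: differentiable_lsubmx.
Qed.

Lemma differentiable_rsub_comp (W : normedModType R) (F : 'rV[R]_n2 -> W)
    (z : 'rV[R]_(n1 + n2)) :
  differentiable F (rsubmx z) -> differentiable (fun y => F (rsubmx y)) z.
Proof.
move=> dF; apply: (@differentiable_comp _ _ _ _ rsubmx F) => //.
exact: differentiable_rsubmx.
Qed.

Lemma derive_lsub_comp (W : normedModType R) (F : 'rV[R]_n1 -> W)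
    (z w : 'rV[R]_(n1 + n2)) : differentiable F (lsubmx z) ->
  'D_w (fun y => F (lsubmx y)) z = 'D_(lsubmx w) F (lsubmx z).
Proof.
move=> dF; rewrite (derive_comp (f := lsubmx) w (differentiable_lsubmx _) dF).
by rewrite derive_linear//; apply: continuous_lsubmx.
Qed.

Lemma derive_rsub_comp (W : normedModType R) (F : 'rV[R]_n2 -> W)
    (z w : 'rV[R]_(n1 + n2)) : differentiable F (rsubmx z) ->
  'D_w (fun y => F (rsubmx y)) z = 'D_(rsubmx w) F (rsubmx z).
Proof.
move=> dF; rewrite (derive_comp (f := rsubmx) w (differentiable_rsubmx _) dF).
by rewrite derive_linear//; apply: continuous_rsubmx.
Qed.

Lemma differentiable_block_diag (V : normedModType R) (f : V -> 'M[R]_n1)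
    (g : V -> 'M[R]_n2) (x : V) : differentiable f x -> differentiable g x ->
  differentiable (fun y => block_mx (f y) 0 0 (g y)) x.
Proof.
move=> df dg; under eq_fun do rewrite block_diag_linear.
by apply: differentiableD; apply: differentiable_linear_comp.
Qed.

Lemma derive_block_diag (V : normedModType R) (f : V -> 'M[R]_n1)
    (g : V -> 'M[R]_n2) (x v : V) : differentiable f x -> differentiable g x ->
  'D_v (fun y => block_mx (f y) 0 0 (g y)) x =
  block_mx ('D_v f x) 0 0 ('D_v g x).
Proof.
move=> df dg; under eq_fun do rewrite block_diag_linear.
rewrite deriveD; try by apply/diff_derivable/differentiable_linear_comp.
by rewrite !derive_linear_comp// -block_diag_linear.
Qed.

Lemma differentiable_row_mx (V : normedModType R) (f : V -> 'rV[R]_n1)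
    (g : V -> 'rV[R]_n2) (x : V) : differentiable f x -> differentiable g x ->
  differentiable (fun y => row_mx (f y) (g y)) x.
Proof.
move=> df dg; under eq_fun do rewrite row_mx_linear.
by apply: differentiableD; apply: differentiable_linear_comp.
Qed.

Lemma derive_row_mx (V : normedModType R) (f : V -> 'rV[R]_n1)
    (g : V -> 'rV[R]_n2) (x v : V) : differentiable f x -> differentiable g x ->
  'D_v (fun y => row_mx (f y) (g y)) x = row_mx ('D_v f x) ('D_v g x).
Proof.
move=> df dg; under eq_fun do rewrite row_mx_linear.
rewrite deriveD; try by apply/diff_derivable/differentiable_linear_comp.
by rewrite !derive_linear_comp// -row_mx_linear.
Qed.

End RowMx.

(** * The Lie derivative of a metric as a bilinear form *)

(** The coordinate expression of the tensor L_X h at [x], where [u] and [v] are tangent vectors at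
    that point instead of vector fields. *)
Definition lie_form (R : realType) (n : nat) (h : 'rV[R]_n -> 'M[R]_n)
    (X : 'rV[R]_n -> 'rV[R]_n) (x u v : 'rV[R]_n) : R :=
  bilin ('D_(X x) h x) u v + bilin (h x) ('D_u X x) v +
  bilin (h x) u ('D_v X x).

(** The terms with ['D_(X x) Y] and ['D_(X x) Z] produced by the Leibniz rule cancel against those
    in the brackets, leaving only derivatives of [h] and [X]. *)
Lemma lie_derivE (R : realType) (n : nat) (h : 'rV[R]_n -> 'M[R]_n)
    (X Y Z : 'rV[R]_n -> 'rV[R]_n) (x : 'rV[R]_n) :
  differentiable h x -> differentiable Y x -> differentiable Z x ->
  lie_deriv h X Y Z x = lie_form h X x (Y x) (Z x).
Proof.
move=> dh dY dZ; rewrite /lie_deriv /bracket derive_bilin//.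
rewrite /lie_form bilinDl bilinDr bilinNl bilinNr.
have cancel_terms (a b c d e : R) : a + b + c - (b - d) - (c - e) = a + d + e.
  by ring.
exact: cancel_terms.
Qed.

Definition differentiable_tensor2 (R : realType) (M : topologicalType) (n : nat)
    (A : atlas R M n) (h : tensor2 A) : Prop :=
  forall i x, codom i x -> differentiable (h i \o par i) x.

(** Constant fields in a chart are smooth and realize every pair of tangent vectors at a point, so
    testing on them suffices. *)
Lemma conformal_withP (R : realType) (M : topologicalType) (n : nat)
    (A : atlas R M n) (h : tensor2 A) (X : vfield A) (rho : M -> R) :
  differentiable_tensor2 h ->
  conformal_with h X rho <->
  [/\ smooth_vfield X, smooth_fun A rho &
    forall (i : idx A) x u v, codom i x ->
      lie_form (h i \o par i) (X i \o par i) x u v =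
      rho (par i x) * bilin (h i (par i x)) u v].
Proof.
move=> dh; split=> -[sX srho Xh]; split=> // i.
  move=> x u v ix.
  have sc w : smooth_on (codom i) (cst w : 'rV[R]_n -> 'rV[R]_n).
    by move=> k; apply: Ck_on_cst.
  have := Xh i (cst u) (cst v) (sc u) (sc v) x ix.
  by rewrite lie_derivE//; apply: dh.
move=> Y Z sY sZ x ix; rewrite lie_derivE ?Xh//; first exact: dh.
  exact: smooth_on_differentiable sY ix.
exact: smooth_on_differentiable sZ ix.
Qed.

(** * Conformal fields on a manifold *)

(* Unlike [smooth_manifold], this passes to products without any work on the
   topology of the product. *)
Definition regular_atlas (R : realType) (M : topologicalType) (n : nat)
    (A : atlas R M n) : Prop :=
  [/\ forall p, exists i : idx A, dom i p,
      forall i : idx A, open (dom i) /\ open (codom i),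
      forall (i : idx A) p, dom i p -> par i (coord i p) = p,
      forall (i : idx A) x, codom i x -> {for x, continuous (par i)} &
      forall (i j : idx A) p, dom i p -> dom j p ->
        differentiable (transition i j) (coord i p)].

Lemma smooth_manifold_regular (R : realType) (M : topologicalType) (n : nat)
    (A : atlas R M n) : smooth_manifold A -> regular_atlas A.
Proof.
move=> [_ [cov op parK cont trans]]; split=> //.
  by move=> i; have [] := cont i.
move=> i j p ip jp; apply: smooth_on_differentiable (trans i j) _.
by exists p.
Qed.

Section Charts.
Variables (R : realType) (M : topologicalType) (n : nat) (A : atlas R M n).
Hypothesis regA : regular_atlas A.

Lemma codom_open (i : idx A) : open (codom i).
Proof. by have [_ /(_ i)[]] := regA. Qed.

Lemma coord_codom (i : idx A) p : dom i p -> codom i (coord i p).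
Proof. by exists p. Qed.

Lemma parK (i : idx A) p : dom i p -> par i (coord i p) = p.
Proof. by have [_ _ /(_ i p)] := regA. Qed.

Lemma par_dom (i : idx A) x : codom i x -> dom i (par i x).
Proof. by case=> p ip <-; rewrite parK. Qed.

Lemma coordK (i : idx A) x : codom i x -> coord i (par i x) = x.
Proof. by case=> p ip <-; rewrite parK. Qed.

Lemma smooth_fun_cst (c : R) : smooth_fun A (cst c).
Proof. by move=> i k; apply: Ck_on_cst. Qed.

(** This is the chart independence of the function X(s). Near the point, [s \o par i] is
    [s \o par j] after the transition map, so the chain rule meets the transformation law of [X]. *)
Lemma derive_chart_change (X : vfield A) (s : M -> R) (i j : idx A) p :
  smooth_vfield X -> smooth_fun A s -> dom i p -> dom j p ->
  'D_(X i p) (s \o par i : 'rV[R]_n -> R^o) (coord i p) =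
  'D_(X j p) (s \o par j : 'rV[R]_n -> R^o) (coord j p).
Proof.
move=> [_ XE] ss ip jp; have [_ op _ cpar dtrans] := regA.
(* Continuity of [par i] and openness of [dom j] give a neighbourhood on which [par j \o coord j]
   may be inserted. *)
have nj : \forall x \near coord i p, dom j (par i x).
  have cp := cpar i _ (coord_codom ip).
  apply: cp; rewrite parK//; apply: open_nbhs_nbhs.
  by split=> //; apply: (op j).1.
have -> : 'D_(X i p) (s \o par i : 'rV[R]_n -> R^o) (coord i p) =
    'D_(X i p) ((s \o par j : 'rV[R]_n -> R^o) \o transition i j) (coord i p).
  apply: near_eq_derive; apply: filterS nj => x jx.
  by rewrite /= /transition /= parK.
have tE : transition i j (coord i p) = coord j p by rewrite /transition /= parK.
rewrite derive_comp; [|exact: dtrans|].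
  by rewrite tE -XE.
by rewrite tE; apply: smooth_on_differentiable (ss j) (coord_codom jp).
Qed.

(** Each term of the Lie form is linear in [X] when the scalar is constant. This serves to bring two
    homothetic fields to a common factor. *)
Lemma conformal_with_scale (h : tensor2 A) (X : vfield A) (a c : R) :
  differentiable_tensor2 h -> conformal_with h X (cst c) ->
  conformal_with h (fun i p => a *: X i p) (cst (a * c)).
Proof.
move=> dh /(conformal_withP X _ dh)[[sX XE] _ Xh].
apply/conformal_withP => //; split; [split| |].
- move=> i.
  exact: (smooth_on_linear (GRing.scale a) (codom_open (i := i)) (sX i)).
- move=> i j p ip jp; rewrite derive_dirZ -?XE//.
  by have [_ _ _ _] := regA; apply.
- exact: smooth_fun_cst.
move=> i x u v ix; have dX := smooth_on_differentiable (sX i) ix.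
have DX w :
    'D_w ((fun p => a *: X i p) \o par i) x = a *: 'D_w (X i \o par i) x.
  by rewrite -deriveZ//; apply: diff_derivable.
rewrite /lie_form !DX derive_dirZ; last exact: dh.
rewrite bilinZl bilinZr bilin_scalem /=.
have := Xh i x u v ix; rewrite /lie_form /= => XH.
by rewrite -mulrA -XH !mulrDr.
Qed.

Lemma conformal_with0 (h : tensor2 A) :
  differentiable_tensor2 h -> conformal_with h (fun _ _ => 0) (cst 0).
Proof.
move=> dh; apply/conformal_withP => //; split; [split| |].
- by move=> i k; apply: Ck_on_cst.
- by move=> i j p ip jp; rewrite derive0.
- exact: smooth_fun_cst.
move=> i x u v ix; rewrite /lie_form derive0 mul0r.
have -> : ((fun _ => 0) \o par i : 'rV[R]_n -> 'rV[R]_n) = cst 0 by [].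
by rewrite !derive_cst /bilin !(mul0mx, mulmx0, linear0) mxE !addr0.
Qed.

Lemma conformal_conformal_change (h : tensor2 A) (X : vfield A) (s : M -> R) :
  differentiable_tensor2 h -> smooth_fun A s -> (forall p, s p != 0) ->
  conformal h X -> conformal (conformal_change s h) X.
Proof.
move=> dh ss s0 [rho /(conformal_withP _ _ dh)[sX srho Xh]].
have dsh : differentiable_tensor2 (conformal_change s h).
  move=> i x ix; apply: (@differentiable_scale _ _ _ _ (s \o par i)).
    exact: smooth_on_differentiable (ss i) ix.
  exact: dh.
(* X(s) becomes a function on all of [M] by computing it at each point in a chosen chart around that
   point; [XsE] then says that any other chart gives the same value, which is what smoothness
   requires. *)
have [/choice[ch chP] _ _ _ _] := regA.
pose Xs p : R :=
  'D_(X (ch p) p) (s \o par (ch p) : 'rV[R]_n -> R^o) (coord (ch p) p).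
have XsE i x : codom i x ->
    Xs (par i x) = 'D_((X i \o par i) x) (s \o par i : 'rV[R]_n -> R^o) x.
  move=> ix; rewrite /Xs (derive_chart_change sX ss (chP _) (par_dom ix)).
  by rewrite coordK.
exists (fun p => rho p + Xs p * (s p)^-1).
apply/conformal_withP => //; split=> //.
  move=> i k; apply: Ck_on_add; [exact: codom_open|exact: srho|].
  apply: Ck_on_mul; [exact: codom_open| |]; last first.
    by apply: Ck_on_inv; [exact: codom_open|move=> x _; apply: s0|exact: ss].
  apply: (Ck_on_eq
    (f := fun x => 'D_((X i \o par i) x) (s \o par i : 'rV[R]_n -> R^o) x)).
  - exact: codom_open.
  - by move=> x ix; rewrite /= XsE.
  - by apply: smooth_on_derive; [exact: codom_open|exact: (sX.1 i)|exact: ss].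
move=> i x u v ix; rewrite /lie_form.
rewrite (@derive_scale _ _ _ _ (s \o par i) (h i \o par i)); last first.
- exact: dh.
- exact: smooth_on_differentiable (ss i) ix.
have := Xh i x u v ix; rewrite /lie_form /conformal_change /=.
rewrite bilin_addm !bilin_scalem XsE//= => XH.
(* The Leibniz term X(s) h is (X(s) / s) (s h) because [s] does not vanish. *)
rewrite mulrDl (mulrCA (rho _)) -XH mulrA mulfVK//.
ring.
Qed.

End Charts.

(** * Products *)

Section Products.
Variables (R : realType) (M1 M2 : topologicalType) (n1 n2 : nat).
Variables (A1 : atlas R M1 n1) (A2 : atlas R M2 n2).
Hypotheses (reg1 : regular_atlas A1) (reg2 : regular_atlas A2).

Lemma codom_prod (i : idx (prod_atlas A1 A2)) z :
  codom i z <-> codom i.1 (lsubmx z) /\ codom i.2 (rsubmx z).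
Proof.
split=> [[p [p1 p2] <-]|[[p p1 pE] [q q2 qE]]].
  by rewrite /= row_mxKl row_mxKr; split; apply: coord_codom.
by exists (p, q) => //=; rewrite pE qE hsubmxK.
Qed.

(** By computation, a transition between product charts is the pair of the factor transitions
    composed with the two projections, so its differential has no mixed terms. *)
Lemma derive_transition_prod (i j : idx (prod_atlas A1 A2)) p w :
  dom i p -> dom j p ->
  'D_w (transition i j) (coord i p) =
  row_mx ('D_(lsubmx w) (transition i.1 j.1) (coord i.1 p.1))
         ('D_(rsubmx w) (transition i.2 j.2) (coord i.2 p.2)).
Proof.
move=> [ip1 ip2] [jp1 jp2].
have [_ _ _ _ /(_ _ _ _ ip1 jp1) d1] := reg1.
have [_ _ _ _ /(_ _ _ _ ip2 jp2) d2] := reg2.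
have e1 : lsubmx (coord i p) = coord i.1 p.1 by rewrite /= row_mxKl.
have e2 : rsubmx (coord i p) = coord i.2 p.2 by rewrite /= row_mxKr.
rewrite -e1 in d1; rewrite -e2 in d2.
rewrite -e1 -e2 -(derive_lsub_comp w d1) -(derive_rsub_comp w d2).
by rewrite -derive_row_mx//; [exact: differentiable_lsub_comp|
  exact: differentiable_rsub_comp].
Qed.

Lemma prod_regular : regular_atlas (prod_atlas A1 A2).
Proof.
have [cov1 op1 pK1 cp1 d1] := reg1; have [cov2 op2 pK2 cp2 d2] := reg2.
split.
- move=> [p q]; have [i ip] := cov1 p; have [j jq] := cov2 q.
  by exists (i, j).
- move=> i; split.
    apply: (openI (A := fst @^-1` dom i.1) (B := snd @^-1` dom i.2)).
      by apply: open_comp (op1 i.1).1 => x _; apply: cvg_fst.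
    by apply: open_comp (op2 i.2).1 => x _; apply: cvg_snd.
  have -> : codom i = lsubmx @^-1` codom i.1 `&` rsubmx @^-1` codom i.2.
    by apply/seteqP; split=> z /codom_prod.
  apply: openI; apply: open_comp.
  + by move=> x _; apply: continuous_lsubmx.
  + exact: (op1 i.1).2.
  + by move=> x _; apply: continuous_rsubmx.
  + exact: (op2 i.2).2.
- by move=> i [p q] [ip iq]; rewrite /= row_mxKl row_mxKr pK1// pK2.
- move=> i z /codom_prod[z1 z2].
  have c1 : {for z, continuous (fun y => par i.1 (lsubmx y))}.
    apply: (@continuous_comp _ _ _ lsubmx (par i.1)); last exact: cp1.
    exact: continuous_lsubmx.
  have c2 : {for z, continuous (fun y => par i.2 (rsubmx y))}.
    apply: (@continuous_comp _ _ _ rsubmx (par i.2)); last exact: cp2.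
    exact: continuous_rsubmx.
  exact: cvg_pair c1 c2.
- move=> i j p [ip1 ip2] [jp1 jp2]; apply: differentiable_row_mx.
    apply: (@differentiable_lsub_comp _ _ _ _ (transition i.1 j.1)).
    by rewrite /= row_mxKl; apply: d1.
  apply: (@differentiable_rsub_comp _ _ _ _ (transition i.2 j.2)).
  by rewrite /= row_mxKr; apply: d2.
Qed.

Lemma smooth_on_lsub_comp (W : normedModType R) (i : idx (prod_atlas A1 A2))
    (F : 'rV[R]_n1 -> W) :
  smooth_on (codom i.1) F -> smooth_on (codom i) (fun z => F (lsubmx z)).
Proof.
(* The projection is put in the affine form of [smooth_on_comp_mx], with translation part 0. *)
move=> sF; under eq_fun do rewrite -[lsubmx _]addr0.
apply: (smooth_on_comp_mx (L := lsubmx)) sF => [|z /codom_prod[z1 _]].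
  exact: (codom_open prod_regular (i := i)).
by rewrite addr0.
Qed.

Lemma smooth_on_rsub_comp (W : normedModType R) (i : idx (prod_atlas A1 A2))
    (F : 'rV[R]_n2 -> W) :
  smooth_on (codom i.2) F -> smooth_on (codom i) (fun z => F (rsubmx z)).
Proof.
move=> sF; under eq_fun do rewrite -[rsubmx _]addr0.
apply: (smooth_on_comp_mx (L := rsubmx)) sF => [|z /codom_prod[_ z2]].
  exact: (codom_open prod_regular (i := i)).
by rewrite addr0.
Qed.

Lemma prod_metricE (h1 : tensor2 A1) (h2 : tensor2 A2) i p :
  prod_metric h1 h2 i p = block_mx (h1 i.1 p.1) 0 0 (h2 i.2 p.2).
Proof. by rewrite /prod_metric /pull1 /pull2 add_block_mx !addr0 add0r. Qed.

(** * Homothetic fields of a product metric *)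

Section Metrics.
Local Notation ppar := (@par _ _ _ (prod_atlas A1 A2)).
Variables (h1 : tensor2 A1) (h2 : tensor2 A2).
Hypotheses (dh1 : differentiable_tensor2 h1) (dh2 : differentiable_tensor2 h2).

Lemma prod_metric_par i : prod_metric h1 h2 i \o par i =
  fun z => block_mx ((h1 i.1 \o par i.1) (lsubmx z)) 0 0
                    ((h2 i.2 \o par i.2) (rsubmx z)).
Proof. by apply/funext => z; rewrite /= prod_metricE. Qed.

Lemma differentiable_prod_metric : differentiable_tensor2 (prod_metric h1 h2).
Proof.
move=> i z /codom_prod[z1 z2]; rewrite prod_metric_par.
apply: differentiable_block_diag.
  by apply: differentiable_lsub_comp; apply: dh1.
by apply: differentiable_rsub_comp; apply: dh2.
Qed.

Lemma derive_prod_metric i z w1 w2 : codom i z ->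
  'D_(row_mx w1 w2) (prod_metric h1 h2 i \o par i) z =
  block_mx ('D_w1 (h1 i.1 \o par i.1) (lsubmx z)) 0 0
           ('D_w2 (h2 i.2 \o par i.2) (rsubmx z)).
Proof.
move=> /codom_prod[z1 z2]; rewrite prod_metric_par.
have d1 := dh1 z1; have d2 := dh2 z2.
rewrite (derive_block_diag _ (differentiable_lsub_comp d1)
  (differentiable_rsub_comp d2)).
rewrite (derive_lsub_comp _ d1) (derive_rsub_comp _ d2).
by rewrite (row_mxKl w1 w2) (row_mxKr w1 w2).
Qed.

(** The Lie form of the product metric is the sum of those of the factors, and a shared constant [c]
    lets the right-hand sides add as well. With one field zero and [c] zero this covers lifts of
    Killing fields. *)
Lemma conformal_with_sum (X1 : vfield A1) (X2 : vfield A2) (c : R) :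
  conformal_with h1 X1 (cst c) -> conformal_with h2 X2 (cst c) ->
  conformal_with (prod_metric h1 h2)
    (fun i p => row_mx (X1 i.1 p.1) (X2 i.2 p.2)) (cst c).
Proof.
move=> /(conformal_withP _ _ dh1)[[s1 E1] _ L1].
move=> /(conformal_withP _ _ dh2)[[s2 E2] _ L2].
have reg := prod_regular.
apply/conformal_withP; first exact: differentiable_prod_metric.
split; [split| |].
- move=> i; have oi := codom_open reg (i := i).
  apply: (@smooth_on_row_mx _ _ _ _ _ (fun z => (X1 i.1 \o par i.1) (lsubmx z))
      (fun z => (X2 i.2 \o par i.2) (rsubmx z))) => //.
    exact: smooth_on_lsub_comp.
  exact: smooth_on_rsub_comp.
- move=> i j p ip jp; rewrite derive_transition_prod// row_mxKl row_mxKr.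
  by case: ip jp => ip1 ip2 [jp1 jp2]; rewrite -E1// -E2.
- exact: smooth_fun_cst.
move=> i z u v iz; have [z1 z2] := (codom_prod i z).1 iz.
have d1 := smooth_on_differentiable (s1 i.1) z1.
have d2 := smooth_on_differentiable (s2 i.2) z2.
have DX w1 w2 :
    'D_(row_mx w1 w2)
      ((fun p => row_mx (X1 i.1 p.1) (X2 i.2 p.2)) \o par i) z =
    row_mx ('D_w1 (X1 i.1 \o par i.1) (lsubmx z))
           ('D_w2 (X2 i.2 \o par i.2) (rsubmx z)).
  have := derive_row_mx (row_mx w1 w2) (differentiable_lsub_comp d1)
    (differentiable_rsub_comp d2).
  rewrite (derive_lsub_comp _ d1) (derive_rsub_comp _ d2).
  by rewrite (row_mxKl w1 w2) (row_mxKr w1 w2).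
rewrite -(hsubmxK u) -(hsubmxK v).
move: (lsubmx u) (rsubmx u) (lsubmx v) (rsubmx v) => u1 u2 v1 v2.
rewrite /lie_form !DX.
have -> : ((fun p => row_mx (X1 i.1 p.1) (X2 i.2 p.2)) \o par i) z =
    row_mx ((X1 i.1 \o par i.1) (lsubmx z))
           ((X2 i.2 \o par i.2) (rsubmx z)) by [].
rewrite (derive_prod_metric _ _ iz).
have -> : (prod_metric h1 h2 i \o par i) z =
    block_mx ((h1 i.1 \o par i.1) (lsubmx z)) 0 0
             ((h2 i.2 \o par i.2) (rsubmx z)).
  by rewrite prod_metric_par.
rewrite prod_metricE !bilin_block_row.
have := L1 i.1 _ u1 v1 z1; have := L2 i.2 _ u2 v2 z2.
rewrite /lie_form /= mulrDr => <- <-; ring.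
Qed.

(** The equation for [X] is tested on vectors [row_mx u 0] and [row_mx v 0] tangent to the slice
    through [q]. Only the first block of the metric then contributes, and [X] is differentiated only
    along the slice. *)
Lemma conformal_with_slice1 (X : vfield (prod_atlas A1 A2)) (c : R)
    (j : idx A2) (q : M2) : dom j q ->
  conformal_with (prod_metric h1 h2) X (cst c) ->
  conformal_with h1 (fun i p => lsubmx (X (i, j) (p, q))) (cst c).
Proof.
move=> jq /(conformal_withP _ _ differentiable_prod_metric)[[sX XE] _ L].
have slice i x : ((fun p => lsubmx (X (i, j) (p, q))) \o par i) x =
    lsubmx ((X (i, j) \o ppar (i, j)) (row_mx x (coord j q))).
  by rewrite /= row_mxKl row_mxKr (parK reg2).
have slice_dom i x : codom i x ->
    @codom _ _ _ (prod_atlas A1 A2) (i, j) (row_mx x (coord j q)).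
  move=> ix; apply/codom_prod; rewrite row_mxKl row_mxKr; split=> //.
  exact: coord_codom.
(* The inclusion of the slice is affine in the chart, so smoothness of [X] restricts along it. *)
have rowE x : row_mx x (coord j q) =
    mulmxr (row_mx 1%:M 0) x + row_mx 0 (coord j q) :> 'rV[R]_(n1 + n2).
  by rewrite /= mul_mx_row mulmx1 mulmx0 add_row_mx addr0 add0r.
apply/conformal_withP => //; split; [split| |].
- move=> i; have oi := codom_open reg1 (i := i).
  have -> : (fun p => lsubmx (X (i, j) (p, q))) \o par i =
      fun x => lsubmx ((X (i, j) \o ppar (i, j))
        (mulmxr (row_mx 1%:M 0) x + row_mx 0 (coord j q))).
    by apply/funext => x; rewrite slice rowE.
  apply: (smooth_on_linear lsubmx oi).
  apply: smooth_on_comp_mx (sX (i, j)) => // x ix.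
  by rewrite -rowE; apply: slice_dom.
- move=> i i' p ip i'p.
  have ip' : @dom _ _ _ (prod_atlas A1 A2) (i, j) (p, q) by [].
  have i'p' : @dom _ _ _ (prod_atlas A1 A2) (i', j) (p, q) by [].
  (* The [M1] block of the product transition acts only on the [M1] component of [X], so that
     component transforms as a field on [M1]. *)
  by rewrite (XE _ _ _ ip' i'p') derive_transition_prod// row_mxKl.
- exact: smooth_fun_cst.
move=> i x u v ix; have iz := slice_dom _ _ ix.
have dX := smooth_on_differentiable (sX (i, j)) iz.
have DX w : 'D_w ((fun p => lsubmx (X (i, j) (p, q))) \o par i) x =
    lsubmx ('D_(row_mx w 0) (X (i, j) \o ppar (i, j))
      (row_mx x (coord j q))).
  have -> : (fun p => lsubmx (X (i, j) (p, q))) \o par i =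
      fun x => lsubmx
        (((X (i, j) \o ppar (i, j)) \o row_mx^~ (coord j q)) x).
    by apply/funext => y; rewrite slice.
  have drow : differentiable (fun y => row_mx y (coord j q)) x.
    exact: differentiable_row_mx.
  have Drow : 'D_w (fun y => row_mx y (coord j q)) x = row_mx w 0.
    rewrite (@derive_row_mx _ _ _ _ id (cst (coord j q)))//.
    by rewrite derive_id derive_cst.
  rewrite derive_linear_comp; last exact: differentiable_comp.
  by rewrite (derive_comp _ drow dX) Drow.
have := L (i, j) _ (row_mx u 0) (row_mx v 0) iz.
rewrite /lie_form !DX.
(* Splitting the value of [X] into components separates the derivative of the metric: the [M2]
   component differentiates only the second block, which the test vectors annihilate. *)
rewrite -(hsubmxK ((X (i, j) \o ppar (i, j))
  (row_mx x (coord j q)))).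
rewrite (derive_prod_metric _ _ iz) -slice.
rewrite !prod_metricE !prod_metric_par !bilin_block.
rewrite (row_mxKl u 0) (row_mxKl v 0) (row_mxKr u 0) (row_mxKr v 0).
rewrite (row_mxKl x (coord j q)) !bilin0l !bilin0r !addr0 => ->.
by rewrite /= (row_mxKl x (coord j q)).
Qed.

(** The mirror argument on the slice of points with first coordinate [q], with test vectors
    [row_mx 0 u] and [row_mx 0 v]. *)
Lemma conformal_with_slice2 (X : vfield (prod_atlas A1 A2)) (c : R)
    (j : idx A1) (q : M1) : dom j q ->
  conformal_with (prod_metric h1 h2) X (cst c) ->
  conformal_with h2 (fun i p => rsubmx (X (j, i) (q, p))) (cst c).
Proof.
move=> jq /(conformal_withP _ _ differentiable_prod_metric)[[sX XE] _ L].
have slice i x : ((fun p => rsubmx (X (j, i) (q, p))) \o par i) x =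
    rsubmx ((X (j, i) \o ppar (j, i)) (row_mx (coord j q) x)).
  by rewrite /= row_mxKl row_mxKr (parK reg1).
have slice_dom i x : codom i x ->
    @codom _ _ _ (prod_atlas A1 A2) (j, i) (row_mx (coord j q) x).
  move=> ix; apply/codom_prod; rewrite row_mxKl row_mxKr; split=> //.
  exact: coord_codom.
have rowE x : row_mx (coord j q) x =
    mulmxr (row_mx 0 1%:M) x + row_mx (coord j q) 0 :> 'rV[R]_(n1 + n2).
  by rewrite /= mul_mx_row mulmx1 mulmx0 add_row_mx add0r addr0.
apply/conformal_withP => //; split; [split| |].
- move=> i; have oi := codom_open reg2 (i := i).
  have -> : (fun p => rsubmx (X (j, i) (q, p))) \o par i =
      fun x => rsubmx ((X (j, i) \o ppar (j, i))
        (mulmxr (row_mx 0 1%:M) x + row_mx (coord j q) 0)).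
    by apply/funext => x; rewrite slice rowE.
  apply: (smooth_on_linear rsubmx oi).
  apply: smooth_on_comp_mx (sX (j, i)) => // x ix.
  by rewrite -rowE; apply: slice_dom.
- move=> i i' p ip i'p.
  have ip' : @dom _ _ _ (prod_atlas A1 A2) (j, i) (q, p) by [].
  have i'p' : @dom _ _ _ (prod_atlas A1 A2) (j, i') (q, p) by [].
  by rewrite (XE _ _ _ ip' i'p') derive_transition_prod// row_mxKr.
- exact: smooth_fun_cst.
move=> i x u v ix; have iz := slice_dom _ _ ix.
have dX := smooth_on_differentiable (sX (j, i)) iz.
have DX w : 'D_w ((fun p => rsubmx (X (j, i) (q, p))) \o par i) x =
    rsubmx ('D_(row_mx 0 w) (X (j, i) \o ppar (j, i))
      (row_mx (coord j q) x)).
  have -> : (fun p => rsubmx (X (j, i) (q, p))) \o par i =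
      fun x => rsubmx (((X (j, i) \o ppar (j, i)) \o row_mx (coord j q)) x).
    by apply/funext => y; rewrite slice.
  have drow : differentiable (fun y => row_mx (coord j q) y) x.
    exact: differentiable_row_mx.
  have Drow : 'D_w (fun y => row_mx (coord j q) y) x = row_mx 0 w.
    rewrite (@derive_row_mx _ _ _ _ (cst (coord j q)) id)//.
    by rewrite derive_id derive_cst.
  rewrite derive_linear_comp; last exact: differentiable_comp.
  by rewrite (derive_comp _ drow dX) Drow.
have := L (j, i) _ (row_mx 0 u) (row_mx 0 v) iz.
rewrite /lie_form !DX.
rewrite -(hsubmxK ((X (j, i) \o ppar (j, i))
  (row_mx (coord j q) x))).
rewrite (derive_prod_metric _ _ iz) -slice.
rewrite !prod_metricE !prod_metric_par !bilin_block.
rewrite (row_mxKl 0 u) (row_mxKl 0 v) (row_mxKr 0 u) (row_mxKr 0 v).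
rewrite (row_mxKr (coord j q) x) !bilin0l !bilin0r !add0r => ->.
by rewrite /= (row_mxKr (coord j q) x).
Qed.

End Metrics.

End Products.

(** * Regularity of the warping factors, and the doubly warped product *)

Lemma smooth_on_sqr (R : realType) (V : normedModType R) (U : set V)
    (f : V -> R^o) : open U ->
  smooth_on U f -> smooth_on U (fun x => f x ^+ 2 : R^o).
Proof. by move=> oU sf k; apply: Ck_on_mul. Qed.

Lemma differentiable_conformal_inv_sqr (R : realType) (M : topologicalType)
    (n : nat) (A : atlas R M n) (h : tensor2 A) (f : M -> R) :
  pseudo_riemannian h -> smooth_fun A f -> (forall p, 0 < f p) ->
  differentiable_tensor2 (conformal_change (fun p => 1 / f p ^+ 2) h).
Proof.
move=> [[sh _] _ _ _] sf f0 i x ix.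
have df : differentiable (f \o par i : 'rV[R]_n -> R) x.
  exact: smooth_on_differentiable (sf i) ix.
apply: (@differentiable_scale _ _ _ _ (fun y => 1 / f (par i y) ^+ 2));
  last first.
  exact: smooth_on_differentiable (sh i) ix.
under eq_fun do rewrite div1r.
apply: (@differentiableV _ _ (fun y => f (par i y) ^+ 2)).
  exact: (@differentiableM _ _ (f \o par i) (f \o par i)).
by rewrite expf_neq0// gt_eqF.
Qed.

Lemma smooth_fun_prod_sqr (R : realType) (M1 M2 : topologicalType)
    (n1 n2 : nat) (A1 : atlas R M1 n1) (A2 : atlas R M2 n2)
    (f1 : M1 -> R) (f2 : M2 -> R) :
  regular_atlas A1 -> regular_atlas A2 ->
  smooth_fun A1 f1 -> smooth_fun A2 f2 ->
  smooth_fun (prod_atlas A1 A2) (fun p => f1 p.1 ^+ 2 * f2 p.2 ^+ 2).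
Proof.
move=> reg1 reg2 s1 s2 i k.
have oi := codom_open (prod_regular reg1 reg2) (i := i).
apply: (@Ck_on_mul _ _ _ _ (fun z => (f1 \o par i.1) (lsubmx z) ^+ 2)
    (fun z => (f2 \o par i.2) (rsubmx z) ^+ 2)) => //.
  apply: (@smooth_on_sqr _ _ _ (fun z => (f1 \o par i.1) (lsubmx z))) => //.
  exact: smooth_on_lsub_comp.
apply: (@smooth_on_sqr _ _ _ (fun z => (f2 \o par i.2) (rsubmx z))) => //.
exact: smooth_on_rsub_comp.
Qed.

Theorem theorem2 (R : realType) (n1 n2 : nat) (M1 M2 : topologicalType)
    (A1 : atlas R M1 n1) (A2 : atlas R M2 n2)
    (hM1 : smooth_manifold A1) (hM2 : smooth_manifold A2)
    (g1 : tensor2 A1) (g2 : tensor2 A2)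
    (hg1 : pseudo_riemannian g1) (hg2 : pseudo_riemannian g2)
    (f1 : M1 -> R) (f2 : M2 -> R)
    (hf1 : smooth_fun A1 f1) (hf2 : smooth_fun A2 f2)
    (f1_gt0 : forall p, 0 < f1 p) (f2_gt0 : forall q, 0 < f2 q) :
  let g := doubly_warped g1 g2 f1 f2 in
  let gbar1 := conformal_change (fun p => 1 / f1 p ^+ 2) g1 in
  let gbar2 := conformal_change (fun q => 1 / f2 q ^+ 2) g2 in
  let gbar := prod_metric gbar1 gbar2 in
  ((forall zeta1 : vfield A1,
      killing gbar1 zeta1 -> killing gbar (lift1 A2 zeta1)) /\
   (forall zeta2 : vfield A2,
      killing gbar2 zeta2 -> killing gbar (lift2 A1 zeta2))) /\
  (((exists zeta : vfield (prod_atlas A1 A2), homothetic gbar zeta) <->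
    (exists zeta1 : vfield A1, homothetic gbar1 zeta1) /\
    (exists zeta2 : vfield A2, homothetic gbar2 zeta2)) /\
   ((exists zeta : vfield (prod_atlas A1 A2), proper_homothetic gbar zeta) <->
    (exists zeta1 : vfield A1, proper_homothetic gbar1 zeta1) /\
    (exists zeta2 : vfield A2, proper_homothetic gbar2 zeta2))) /\
  (forall zeta : vfield (prod_atlas A1 A2),
     conformal gbar zeta -> conformal g zeta).
Proof.
move=> g gbar1 gbar2 gbar.
have reg1 := smooth_manifold_regular hM1.
have reg2 := smooth_manifold_regular hM2.
have reg := prod_regular reg1 reg2.
have d1 : differentiable_tensor2 gbar1.
  exact: differentiable_conformal_inv_sqr.
have d2 : differentiable_tensor2 gbar2.
  exact: differentiable_conformal_inv_sqr.
have dg : differentiable_tensor2 gbar by exact: differentiable_prod_metric.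
have sum := conformal_with_sum reg1 reg2 d1 d2.
(* Manifolds are nonempty, which supplies the points, with charts around them, through which the
   slices are taken. *)
have [[[p0 _] _ _] [/(_ p0)[i0 ip0] _ _ _ _]] := hM1.
have [[[q0 _] _ _] [/(_ q0)[j0 jq0] _ _ _ _]] := hM2.
have slice1 := conformal_with_slice1 reg1 reg2 d1 d2 jq0.
have slice2 := conformal_with_slice2 reg1 reg2 d1 d2 ip0.
have zero1 := conformal_with0 d1; have zero2 := conformal_with0 d2.
split; [split=> Z KZ|split; [split; split|]].
(* A lift is by computation the sum of the given field and the zero field of the other factor, both
   with factor 0. *)
- exact: sum KZ zero2.
- exact: sum zero1 KZ.
- move=> [Z [c Zc]]; split; eexists; exists c; first exact: slice1 Zc.
  exact: slice2 Zc.
(* A homothetic field may have factor 0, so the sum of the two zero fields is a witness. *)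
- by move=> _; eexists; exists 0; apply: sum zero1 zero2.
- move=> [Z [c c0 Zc]]; split; eexists; exists c => //; first exact: slice1 Zc.
  exact: slice2 Zc.
- move=> [[Z1 [c1 c10 Z1c]] [Z2 [c2 c20 Z2c]]].
  (* Since [c2] is nonzero, multiplying [Z2] by [c1 / c2] changes its factor to [c1], that of [Z1],
     and the two fields can be added. *)
  have := conformal_with_scale reg2 (c1 / c2) d2 Z2c.
  rewrite (divfK c20 c1) => Z2c1.
  by eexists; exists c1; [exact: c10|exact: sum Z1c Z2c1].
(* Multiplication by [s] turns the coefficient [1 / f1 ^+ 2] of [g1] into [f2 ^+ 2], and the
   coefficient [1 / f2 ^+ 2] of [g2] into [f1 ^+ 2], which are the coefficients in [g]. *)
move=> Z; pose s (p : M1 * M2) := f1 p.1 ^+ 2 * f2 p.2 ^+ 2.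
have f1_neq0 p : f1 p != 0 by rewrite gt_eqF.
have f2_neq0 q : f2 q != 0 by rewrite gt_eqF.
have -> : g = conformal_change s gbar.
  apply/funext => i; apply/funext => p.
  rewrite /g /gbar /doubly_warped /conformal_change /prod_metric /pull1 /pull2.
  rewrite !add_block_mx !scale_block_mx !add_block_mx !(addr0, add0r, scaler0).
  rewrite /s /gbar1 /gbar2 /conformal_change !scalerA.
  by congr (block_mx (_ *: _) _ _ (_ *: _)); field; rewrite ?f1_neq0 ?f2_neq0.
apply: conformal_conformal_change => //; last first.
  by move=> p; rewrite mulf_neq0// expf_neq0.
exact: smooth_fun_prod_sqr.
Qed.
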